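(* Consider any algorithm that selects a sequence of pairs $(x_t,y_t)\in\Delta_X\times\Delta_Y$ given the past payoff matrices $A_1,\dots,A_{t-1}$. Consider the following three objectives: $$\text{(i)}\quad \Bigl|\sum_{t=1}^Tx_t^\top A_ty_t-\min_{x\in\Delta_X}\max_{y\in\Delta_Y}\sum_{t=1}^Tx^\top A_ty\Bigr|=o(T),$$ $$\text{(ii)}\quad \sum_{t=1}^Tx_t^\top A_ty_t-\min_{x\in\Delta_X}\sum_{t=1}^Tx^\top A_ty_t=o(T),$$ $$\text{(iii)}\quad \max_{y\in\Delta_Y}\sum_{t=1}^Tx_t^\top A_ty-\sum_{t=1}^Tx_t^\top A_ty_t=o(T).$$ Then there exists an (adversarially chosen) sequence $A_1,A_2,\dots$ such that not all of (i), (ii) and (iii) are true.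
   Context: Online matrix games: player 1 has $d_1$ actions and player 2 has $d_2$ actions. At each time step $t=1,\dots,T$ the payoff is given by a matrix $A_t\in[-1,1]^{d_1\times d_2}$, which is revealed after the players choose $x_t\in\Delta_X$ and $y_t\in\Delta_Y$; player 1 incurs loss, and player 2 receives reward, $x_t^\top A_ty_t$. Here $\Delta_X=\{x\in\mathbb{R}^{d_1}:x\ge0,\|x\|_1=1\}$ and $\Delta_Y=\{y\in\mathbb{R}^{d_2}:y\ge0,\|y\|_1=1\}$ are the probability simplexes.
   Formalization: The formal theorem assumes that each player has at least two actions (d_1, d_2 ≥ 2); if a player has only one action the claim is false, since the other player can use a no-regret algorithm such as Hedge to achieve (i), (ii) and (iii). *)

(* Defs.v *)
From mathcomp Require Import all_boot all_order all_algebra.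
From mathcomp Require Import all_classical all_reals all_analysis.
Set Implicit Arguments.
Unset Strict Implicit.
Unset Printing Implicit Defensive.
Import Order.TTheory GRing.Theory Num.Theory.
Import numFieldNormedType.Exports.
Local Open Scope classical_set_scope.
Local Open Scope ring_scope.

Definition simplex (R : realType) (d : nat) : set 'rV[R]_d :=
  [set x | (forall i, 0 <= x 0 i) /\ \sum_i `|x 0 i| = 1].
Arguments simplex : clear implicits.

(* Mixed strategies are row vectors: this is the bilinear form x^T A y. *)
Definition payoff (R : realType) (d1 d2 : nat)
    (A : 'M[R]_(d1, d2)) (x : 'rV[R]_d1) (y : 'rV[R]_d2) : R :=
  (x *m A *m y^T) 0 0.

Definition payoff_matrix (R : realType) (d1 d2 : nat) (A : 'M[R]_(d1, d2)) :=
  forall i j, -1 <= A i j <= 1.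

(* When f is continuous and 0 < d the bounds are attained, so these are a
   genuine maximum and minimum: see max_simplexP and min_simplexP. All the
   functions they are applied to are continuous: see
   cumulative_payoff_continuous_l, cumulative_payoff_continuous_r and
   max_payoff_continuous. *)
Definition max_simplex (R : realType) (d : nat) (f : 'rV[R]_d -> R) : R :=
  sup (f @` simplex R d).

Definition min_simplex (R : realType) (d : nat) (f : 'rV[R]_d -> R) : R :=
  inf (f @` simplex R d).

(* An algorithm maps the list of the past payoff matrices, oldest first, to
   the next pair of mixed strategies. Rounds are numbered from 0. *)
Definition strategy (R : realType) (d1 d2 : nat) : Type :=
  seq 'M[R]_(d1, d2) -> 'rV[R]_d1 * 'rV[R]_d2.

Definition valid_strategy (R : realType) (d1 d2 : nat) (s : strategy R d1 d2) :=
  forall h : seq 'M[R]_(d1, d2),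
    (forall A, A \in h -> payoff_matrix A) ->
    simplex R d1 (s h).1 /\ simplex R d2 (s h).2.

Section Play.
Variables (R : realType) (d1 d2 : nat).
Variables (s : strategy R d1 d2) (A : nat -> 'M[R]_(d1, d2)).

Definition play_x (t : nat) : 'rV[R]_d1 := (s (mkseq A t)).1.
Definition play_y (t : nat) : 'rV[R]_d2 := (s (mkseq A t)).2.

Definition cumulative_payoff (T : nat) : R :=
  \sum_(t < T) payoff (A t) (play_x t) (play_y t).

Definition saddle_gap (T : nat) : R :=
  cumulative_payoff T -
  min_simplex (fun x => max_simplex (fun y => \sum_(t < T) payoff (A t) x y)).

Definition regret_x (T : nat) : R :=
  cumulative_payoff T -
  min_simplex (fun x => \sum_(t < T) payoff (A t) x (play_y t)).

Definition regret_y (T : nat) : R :=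
  max_simplex (fun y => \sum_(t < T) payoff (A t) (play_x t) y) -
  cumulative_payoff T.
End Play.

Definition sublinear (R : realType) (f : nat -> R) : Prop :=
  f =o_\oo (fun T : nat => T%:R : R).

(* f(T) <= o(T): a regret is allowed to be very negative. *)
Definition sublinear_above (R : realType) (f : nat -> R) : Prop :=
  exists2 g : nat -> R, sublinear g & forall T, f T <= g T.

Lemma sublinearW (R : realType) (f : nat -> R) :
  sublinear f -> sublinear_above f.
Proof. by move=> fo; exists f. Qed.

Section Attained.
Variable R : realType.

Lemma continuous_sum (T : topologicalType) n (F : 'I_n -> T -> R) :
  (forall i, continuous (F i)) -> continuous (fun x => \sum_(i < n) F i x).
Proof.
move=> cF; apply: continuous_big => // x.
exact: (@add_continuous R^o).
Qed.

Lemma simplex_norm_le1 d (x : 'rV[R]_d) i : simplex R d x -> `|x 0 i| <= 1.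
Proof.
move=> [x0 <-]; rewrite (bigD1 i)//= lerDl sumr_ge0// => j _; exact: normr_ge0.
Qed.

Lemma compact_simplex d : compact (simplex R d).
Proof.
apply: bounded_closed_compact.
- exists 1; split; first exact: num_real.
  move=> M M1 x /= hx; rewrite [leLHS]/Num.norm /= mx_normrE.
  apply/bigmax_leP; split; first by rewrite ltW// (lt_trans _ M1).
  move=> [i j] _ /=; rewrite ord1.
  exact: le_trans (simplex_norm_le1 _ hx) (ltW M1).
- have -> : simplex R d = (\bigcap_(i in [set: 'I_d]) [set x | 0 <= x 0 i])
     `&` [set x | \sum_i `|x 0 i| = 1].
    apply/seteqP; split => x /= [h1 h2]; split => // i; last exact: h1.
    by move=> _; exact: h1.
  apply: closedI.
    apply: closed_bigI => i _.
    apply: (@preimage_closed _ _ (fun x : 'rV[R]_d => x 0 i) [set t | 0 <= t]).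
      by move=> x _; exact: coord_continuous.
    exact: closed_ge.
  apply: (@preimage_closed _ _ (fun x : 'rV[R]_d => \sum_i `|x 0 i|) [set t | t = 1]).
    move=> x _; apply: continuous_sum => i {}x.
    apply: (@continuous_comp _ _ _ (fun x : 'rV[R]_d => x 0 i) Num.norm).
      exact: coord_continuous.
    exact: (@norm_continuous _ R^o).
  exact: closed_eq.
Qed.

Lemma simplex_nonempty d : (0 < d)%N -> simplex R d !=set0.
Proof.
case: d => // d _; exists (delta_mx 0 0); split.
  by move=> i; rewrite mxE.
rewrite (bigD1 ord0)//= big1 ?addr0 => [|i /negPf i0]; rewrite mxE.
  by rewrite !eqxx normr1.
by rewrite i0 andbF normr0.
Qed.

Lemma max_simplexP d (f : 'rV[R]_d -> R) : (0 < d)%N -> continuous f ->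
  exists2 x, simplex R d x & max_simplex f = f x /\
    forall y, simplex R d y -> f y <= f x.
Proof.
move=> d0 cf.
have [x] := compact_EVT_max (simplex_nonempty d0) (@compact_simplex d)
  (continuous_subspaceT cf).
rewrite inE => xS xmax.
have {}xmax y : simplex R d y -> f y <= f x by move=> yS; apply: xmax; rewrite inE.
exists x => //; split => //; apply/eqP; rewrite eq_le; apply/andP; split.
  apply: ge_sup; first by exists (f x), x.
  by move=> _ [y yS <-]; exact: xmax.
apply: ub_le_sup; last by exists x.
by exists (f x) => _ [y yS <-]; exact: xmax.
Qed.

Lemma min_simplexP d (f : 'rV[R]_d -> R) : (0 < d)%N -> continuous f ->
  exists2 x, simplex R d x & min_simplex f = f x /\
    forall y, simplex R d y -> f x <= f y.
Proof.
move=> d0 cf.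
have cNf : continuous (fun x => - f x).
  by move=> x; apply: continuousN; exact: cf.
have [x xS [xE xmax]] := max_simplexP d0 cNf.
have {}xmax y : simplex R d y -> f x <= f y by move=> /xmax; rewrite lerN2.
exists x => //; split => //; apply/eqP; rewrite eq_le; apply/andP; split.
  apply: ge_inf; last by exists x.
  by exists (f x) => _ [y yS <-]; exact: xmax.
apply: lb_le_inf; first by exists (f x), x.
by move=> _ [y yS <-]; exact: xmax.
Qed.

Lemma continuous_mulr (T : topologicalType) (f : T -> R) c :
  continuous f -> continuous (fun x => f x * c).
Proof. by move=> cf x; apply: (@cvgMr_tmp _ _ (nbhs x)); exact: cf. Qed.

Lemma payoffE d1 d2 (A : 'M[R]_(d1, d2)) x y :
  payoff A x y = \sum_j (\sum_i x 0 i * A i j) * y 0 j.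
Proof. by rewrite /payoff mxE; apply: eq_bigr => j _; rewrite !mxE. Qed.

Lemma cumulative_payoff_continuous_l d1 d2 T (A : nat -> 'M[R]_(d1, d2)) y :
  continuous (fun x => \sum_(t < T) payoff (A t) x (y t)).
Proof.
apply: continuous_sum => t.
rewrite (_ : payoff (A t) ^~ (y t) =
  fun x => \sum_j (\sum_i x 0 i * A t i j) * y t 0 j); last first.
  by apply/funext => x; rewrite payoffE.
apply: continuous_sum => j; apply: continuous_mulr.
apply: continuous_sum => i; apply: continuous_mulr.
exact: coord_continuous.
Qed.

Lemma cumulative_payoff_continuous_r d1 d2 T (A : nat -> 'M[R]_(d1, d2)) x :
  continuous (fun y => \sum_(t < T) payoff (A t) (x t) y).
Proof.
apply: continuous_sum => t.
rewrite (_ : payoff (A t) (x t) =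
  fun y => \sum_j y 0 j * (\sum_i x t 0 i * A t i j)); last first.
  by apply/funext => y; rewrite payoffE; apply: eq_bigr => j _; rewrite mulrC.
apply: continuous_sum => j; apply: continuous_mulr.
exact: coord_continuous.
Qed.

Lemma payoff_lipschitz d1 d2 (A : 'M[R]_(d1, d2)) x x' y : simplex R d2 y ->
  payoff A x y <= payoff A x' y + (\sum_j \sum_i `|A i j|) * `|x - x'|.
Proof.
move=> yS; rewrite -lerBlDl !payoffE -sumrB [leRHS]mulr_suml.
apply: ler_sum => j _; rewrite -mulrBl -sumrB [leRHS]mulr_suml.
apply: le_trans (ler_norm _) _; rewrite normrM.
apply: le_trans (ler_pM _ _ (lexx _) (simplex_norm_le1 j yS)) _ => //.
rewrite mulr1; apply: le_trans (ler_norm_sum _ _ _) _.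
apply: ler_sum => i _; rewrite -mulrBl normrM mulrC ler_wpM2l//.
rewrite [leRHS]/Num.norm /= mx_normrE.
by apply: le_trans (le_bigmax _ _ (0, i)); rewrite /= !mxE.
Qed.

Lemma max_payoff_continuous d1 d2 T (A : nat -> 'M[R]_(d1, d2)) : (0 < d2)%N ->
  continuous (fun x => max_simplex (fun y => \sum_(t < T) payoff (A t) x y)).
Proof.
move=> d20; set g := (g in continuous g).
pose C := \sum_(t < T) \sum_j \sum_i `|A t i j|.
have gC x x' : g x <= g x' + C * `|x - x'|.
  have [y yS [gx _]] := max_simplexP d20
    (@cumulative_payoff_continuous_r _ _ T A (fun=> x)).
  have [y' _ [gx' /(_ y yS) le_gx']] := max_simplexP d20
    (@cumulative_payoff_continuous_r _ _ T A (fun=> x')).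
  rewrite /g gx gx'; apply: le_trans (lerD le_gx' (lexx _)).
  rewrite mulr_suml -big_split; apply: ler_sum => t _.
  exact: payoff_lipschitz.
move=> x.
have cC : C * `|x - z| @[z --> x] --> (0 : R).
  rewrite -(mulr0 C) -[X in _ --> C * X](normr0 'rV[R]_d1) -(subrr x).
  apply: (@cvgMl_tmp _ _ (nbhs x)); apply: cvg_norm.
  by apply: cvgB; [exact: cvg_cst|exact: cvg_id].
apply: (@squeeze_cvgr _ (nbhs x) _ R (fun z => g x - C * `|x - z|)
  (fun z => g x + C * `|x - z|)).
- near=> z; rewrite lerBlDr gC/=.
  by rewrite distrC gC.
- rewrite -[X in _ --> X]subr0.
  by apply: (@cvgB _ _ _ (nbhs x)) => //; exact: cvg_cst.
- rewrite -[X in _ --> X]addr0.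
  by apply: (@cvgD _ _ _ (nbhs x)) => //; exact: cvg_cst.
Unshelve. all: by end_near. Qed.

End Attained.

(* Main.v *)
(** The adversary alternates, on blocks of lengths growing like [32 ^ k],
    between matching pennies [M] and a game [N] in which each player has a
    dominant action.  Writing [a, b] in [[-1, 1]] for the biases of the two
    mixed strategies, [M] has payoff [ab] and [N] has payoff [(a + b) / 2].
    Both have value [0], whereas [M + N] has payoff
    [(a + 1/2)(b + 1/2) - 1/4], hence value [-1/4].  After a block of [M] ending
    at time [T], (i) makes the cumulative payoff [o(T)], so by (iii) [a] is
    nearly balanced over that block, up to the short history preceding it.
    After [T] further rounds of [N], player 2 comparing with the constant [b = 1]
    forces by (iii) a cumulative payoff at least [- o(T)], whereas (i) forces it
    down to about [- T / 4]. *)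

Require Import Defs.
From mathcomp Require Import all_boot all_order all_algebra.
From mathcomp Require Import all_classical all_reals all_analysis.
From mathcomp Require Import ring lra zify.
Import Order.TTheory GRing.Theory Num.Theory.
Import numFieldNormedType.Exports.
Local Open Scope classical_set_scope.
Local Open Scope ring_scope.

(** On the simplex: weight of even-indexed actions minus weight of odd-indexed ones. It reduces
    games of any size to one number in [-1, 1] per player. *)
Definition bias {R : realType} {d : nat} (x : 'rV[R]_d) : R :=
  \sum_i x 0 i * (-1) ^+ i.

Definition pennies (R : realType) (d1 d2 : nat) : 'M[R]_(d1, d2) :=
  \matrix_(i, j) ((-1) ^+ i * (-1) ^+ j).

Definition dominant (R : realType) (d1 d2 : nat) : 'M[R]_(d1, d2) :=
  \matrix_(i, j) (((-1) ^+ i + (-1) ^+ j) / 2).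

(** Phase [k] starts at round [32 ^ k]; round 0 joins phase 0, since [trunc_log 32 0 = 0]. *)
Definition blocks (R : realType) (d1 d2 : nat) (t : nat) : 'M[R]_(d1, d2) :=
  if odd (trunc_log 32 t) then dominant R d1 d2 else pennies R d1 d2.

(** * Payoffs of the two games in terms of biases *)

Section Biases.
Context {R : realType}.

Lemma simplex_sum1 {d} {x : 'rV[R]_d} : simplex R d x -> \sum_i x 0 i = 1.
Proof. by move=> [x0 <-]; apply: eq_bigr => i _; rewrite ger0_norm. Qed.

Lemma signr_bounds n : -1 <= (-1 : R) ^+ n <= 1.
Proof. by rewrite -signr_odd; case: (odd n); rewrite ?expr0 ?expr1; lra. Qed.

Lemma bias_bounds {d} {x : 'rV[R]_d} : simplex R d x -> -1 <= bias x <= 1.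
Proof.
move=> xS; have [x0 _] := xS; rewrite -ler_norml -[leRHS](simplex_sum1 xS).
apply: le_trans (ler_norm_sum _ _ _) _; apply: ler_sum => i _.
by rewrite normrM normr_sign mulr1 ger0_norm.
Qed.

Lemma exists_bias {d} (a : R) : (2 <= d)%N -> -1 <= a <= 1 ->
  exists2 x, simplex R d x & bias x = a.
Proof.
case: d => [|[|d]]// _ a1.
exists (\row_i (if i == 0 then (1 + a) / 2
                else if i == 1 then (1 - a) / 2 else 0)).
  split=> [i|].
    by rewrite mxE; case: ifP => _; [lra|case: ifP => _ //; lra].
  rewrite !big_ord_recl big1 => [|i _]; rewrite !mxE/= ?normr0//.
  rewrite !ger0_norm; lra.
rewrite /bias !big_ord_recl big1 => [|i _]; rewrite !mxE/= ?mul0r//.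
by rewrite expr0 /bump/= expr1; lra.
Qed.

Lemma payoff_pennies d1 d2 (x : 'rV[R]_d1) (y : 'rV[R]_d2) :
  payoff (pennies R d1 d2) x y = bias x * bias y.
Proof.
rewrite payoffE /bias mulr_sumr; apply: eq_bigr => j _.
rewrite !mulr_suml; apply: eq_bigr => i _; rewrite mxE; ring.
Qed.

Lemma payoff_dominant d1 d2 (x : 'rV[R]_d1) (y : 'rV[R]_d2) :
  simplex R d1 x -> simplex R d2 y ->
  payoff (dominant R d1 d2) x y = (bias x + bias y) / 2.
Proof.
move=> xS yS; rewrite payoffE.
transitivity (\sum_j (bias x / 2 * y 0 j + y 0 j * (-1) ^+ j / 2)).
  (* Inserting the total mass 1 of [x] turns the term in [j] alone into a sum over [i]. *)
  apply: eq_bigr => j _; rewrite -[y 0 j * _]mul1r -[X in X * (y 0 j * _)](simplex_sum1 xS).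
  rewrite /bias !mulr_suml -big_split/=; apply: eq_bigr => i _.
  rewrite mxE; ring.
by rewrite big_split/= -mulr_sumr (simplex_sum1 yS) -mulr_suml -/(bias y); lra.
Qed.

Lemma payoff_bounds {d1 d2} {A : 'M[R]_(d1, d2)} {x y} : payoff_matrix A ->
  simplex R d1 x -> simplex R d2 y -> -1 <= payoff A x y <= 1.
Proof.
move=> A1 xS yS; have [x0 _] := xS; have [y0 _] := yS.
rewrite payoffE -ler_norml -[leRHS](simplex_sum1 yS).
apply: le_trans (ler_norm_sum _ _ _) _; apply: ler_sum => j _.
rewrite normrM (ger0_norm (y0 j)) ler_piMl// -[leRHS](simplex_sum1 xS).
apply: le_trans (ler_norm_sum _ _ _) _; apply: ler_sum => i _.
by rewrite normrM (ger0_norm (x0 i)) ler_piMr// ler_norml.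
Qed.

Lemma blocks_payoff_matrix d1 d2 t : payoff_matrix (blocks R d1 d2 t).
Proof.
move=> i j; rewrite /blocks; case: ifP => _; rewrite mxE.
  by have := signr_bounds i; have := signr_bounds j; lra.
by rewrite -exprD signr_bounds.
Qed.

Lemma sublinear_le {f : nat -> R} {e : R} : 0 < e -> sublinear f ->
  exists n0, forall n, (n0 <= n)%N -> `|f n| <= e * n%:R.
Proof.
move=> e0 /eqoP /(_ _ e0) [n0 _ fe]; exists n0 => n /fe /=.
by rewrite (ger0_norm (ler0n _ _)).
Qed.

End Biases.

(** * Comparison with fixed strategies in hindsight *)

Section Hindsight.
Context {R : realType} {d1 d2 : nat}.
Variables (s : strategy R d1 d2) (A : nat -> 'M[R]_(d1, d2)) (T : nat).
Hypotheses (d1_gt0 : (0 < d1)%N) (d2_gt0 : (0 < d2)%N).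

Lemma regret_y_ge {y} : simplex R d2 y ->
  \sum_(t < T) payoff (A t) (play_x s A t) y <=
  cumulative_payoff s A T + regret_y s A T.
Proof.
move=> yS; rewrite /regret_y addrC subrK.
have [z _ [-> zmax]] := max_simplexP d2_gt0
  (@cumulative_payoff_continuous_r _ _ _ T A (play_x s A)).
exact: zmax.
Qed.

(** Take [y] a best response to [x]: its total payoff is at least the min-max value. *)
Lemma saddle_gap_ge {x} : simplex R d1 x ->
  exists2 y, simplex R d2 y &
    cumulative_payoff s A T <= \sum_(t < T) payoff (A t) x y + saddle_gap s A T.
Proof.
move=> xS.
have [y yS [yE _]] := max_simplexP d2_gt0
  (@cumulative_payoff_continuous_r _ _ _ T A (fun=> x)).
have [z _ [zE zmin]] := min_simplexP d1_gt0
  (@max_payoff_continuous _ d1 _ T A d2_gt0).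
exists y => //; rewrite /saddle_gap zE -yE.
by have := zmin _ xS; lra.
Qed.

End Hindsight.

Lemma play_simplex {R : realType} {d1 d2 : nat} {s : strategy R d1 d2}
    {A : nat -> 'M[R]_(d1, d2)} t :
  valid_strategy s -> (forall t, payoff_matrix (A t)) ->
  simplex R d1 (play_x s A t) /\ simplex R d2 (play_y s A t).
Proof. by move=> sv A1; apply: sv => B /mapP[u _ ->]. Qed.

(** * A pennies block followed by a dominant block *)

Section TwoBlocks.
Context {R : realType} {d1 d2 : nat}.
Variables (A : nat -> 'M[R]_(d1, d2)) (W T : nat).
Hypotheses (A1 : forall t, payoff_matrix (A t)) (WT : (W <= T)%N).
Hypothesis A_pennies :
  forall t, (W <= t < T)%N -> A t = pennies R d1 d2.
Hypothesis A_dominant :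
  forall t, (T <= t < T + T)%N -> A t = dominant R d1 d2.
Variables (x : nat -> 'rV[R]_d1) (y : nat -> 'rV[R]_d2).
Hypotheses (xS : forall t, simplex R d1 (x t)).
Hypotheses (yS : forall t, simplex R d2 (y t)).

Let prefix_bounds : - W%:R <= \sum_(0 <= t < W) payoff (A t) (x t) (y t) <= W%:R.
Proof.
rewrite -ler_norml; apply: le_trans (ler_norm_sum _ _ _) _.
have -> : W%:R = \sum_(0 <= t < W) 1 :> R.
  by rewrite sumr_const_nat subn0.
by apply: ler_sum => t _; rewrite ler_norml payoff_bounds.
Qed.

(** The history before [W] is unknown, but each of its rounds pays at most 1 in absolute value.
    Keeping [x] and [y] arbitrary covers both actual play and constant comparators. *)
Lemma sum_pennies_block :
  `|\sum_(t < T) payoff (A t) (x t) (y t) -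
    \sum_(W <= t < T) bias (x t) * bias (y t)| <= W%:R.
Proof.
rewrite -(big_mkord predT (fun t => payoff (A t) (x t) (y t))).
rewrite (big_cat_nat (leq0n W) WT)/=.
under [X in _ + X - _]eq_big_nat => t tWT.
  rewrite A_pennies// payoff_pennies; over.
by rewrite addrK ler_norml.
Qed.

Lemma sum_dominant_block :
  \sum_(t < T + T) payoff (A t) (x t) (y t) =
  \sum_(t < T) payoff (A t) (x t) (y t) +
  \sum_(T <= t < T + T) (bias (x t) + bias (y t)) / 2.
Proof.
rewrite -!(big_mkord predT (fun t => payoff (A t) (x t) (y t))).
rewrite (big_cat_nat (leq0n T) (leq_addr T T))/=; congr (_ + _).
by apply: eq_big_nat => t tT; rewrite A_dominant// payoff_dominant.
Qed.

End TwoBlocks.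

(** * The inequality forced by small regrets *)

Section Contradiction.
Context {R : realType} {d1 d2 : nat}.
Hypotheses (d1_ge2 : (2 <= d1)%N) (d2_ge2 : (2 <= d2)%N).
Variables (s : strategy R d1 d2) (A : nat -> 'M[R]_(d1, d2)) (W T : nat).
Hypotheses (sv : valid_strategy s) (A1 : forall t, payoff_matrix (A t)).
Hypothesis WT : (W <= T)%N.
Hypothesis A_pennies :
  forall t, (W <= t < T)%N -> A t = pennies R d1 d2.
Hypothesis A_dominant :
  forall t, (T <= t < T + T)%N -> A t = dominant R d1 d2.

Lemma regrets_two_blocks (e : R) :
  saddle_gap s A T <= e -> regret_y s A T <= e ->
  saddle_gap s A (T + T) <= 2 * e -> regret_y s A (T + T) <= 2 * e ->
  T%:R / 4 <= 9 / 2 * W%:R + 6 * e.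
Proof.
move=> gap1 reg1 gap2 reg2.
have xS t : simplex R d1 (play_x s A t) by have [] := play_simplex t sv A1.
have d1_gt0 : (0 < d1)%N by exact: ltnW.
have d2_gt0 : (0 < d2)%N by exact: ltnW.
have block1 x y := sum_pennies_block A W T A1 WT A_pennies x y.
have block2 x y := sum_dominant_block A T A_dominant x y.
have [x0 x0S x0E] : exists2 x, simplex R d1 x & bias x = 0.
  by apply: exists_bias => //; lra.
(* At a = -1/2 the sum ab + (a + b)/2 is -1/4 for every b. *)
have [xh xhS xhE] : exists2 x, simplex R d1 x & bias x = - (1 / 2).
  by apply: exists_bias => //; lra.
have [y1 y1S y1E] : exists2 y, simplex R d2 y & bias y = 1.
  by apply: exists_bias => //; lra.
have [yN yNS yNE] : exists2 y, simplex R d2 y & bias y = -1.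
  by apply: exists_bias => //; lra.
have P1_le : cumulative_payoff s A T <= W%:R + e.
  have [y yS] := saddle_gap_ge s A T d1_gt0 d2_gt0 x0S.
  have := block1 (fun=> x0) (fun=> y) (fun=> x0S) (fun=> yS).
  rewrite [X in _ - X]big1 => [|t _]; last by rewrite x0E mul0r.
  by rewrite subr0 ler_norml; lra.
set a := \sum_(W <= t < T) bias (play_x s A t).
(* Constant bias -1 would have earned player 2 about [- a] on the pennies block. *)
have a_ge : - a <= 2 * W%:R + 2 * e.
  have := regret_y_ge s A T d2_gt0 yNS.
  have := block1 (play_x s A) (fun=> yN) xS (fun=> yNS).
  by rewrite -mulr_suml -/a yNE ler_norml; lra.
(* Constant bias 1 earns about [a] on the pennies block and never loses in a dominant round. *)
have P2_ge : - (3 * W%:R + 4 * e) <= cumulative_payoff s A (T + T).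
  have := regret_y_ge s A (T + T) d2_gt0 y1S.
  rewrite (block2 _ (fun=> y1))//.
  have := block1 (play_x s A) (fun=> y1) xS (fun=> y1S).
  rewrite -mulr_suml -/a y1E ler_norml.
  have : 0 <= \sum_(T <= t < T + T) (bias (play_x s A t) + 1) / 2.
    by apply: sumr_ge0 => t _; have := bias_bounds (xS t); lra.
  lra.
(* With b the bias of [y], the blocks pay -(T - W)b/2 and Tb/2 - T/4, in total Wb/2 - T/4. *)
have [y yS] := saddle_gap_ge s A (T + T) d1_gt0 d2_gt0 xhS.
rewrite (block2 (fun=> xh) (fun=> y))//.
have := block1 (fun=> xh) (fun=> y) (fun=> xhS) (fun=> yS).
have sum_cst (c : R) m n : (m <= n)%N ->
    \sum_(m <= t < n) c = c * (n%:R - m%:R).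
  by move=> mn; rewrite sumr_const_nat -[c *+ _]mulr_natr natrB.
rewrite !sum_cst ?leq_addr// natrD xhE ler_norml.
have W0 : 0 <= W%:R :> R by exact: ler0n.
have : W%:R * bias y <= W%:R.
  by rewrite ler_piMr//; have := bias_bounds yS; lra.
lra.
Qed.

End Contradiction.

Theorem theorem6 (R : realType) (d1 d2 : nat)
    (hd1 : (2 <= d1)%N) (hd2 : (2 <= d2)%N)
    (s : strategy R d1 d2) (hs : valid_strategy s) :
  exists A : nat -> 'M[R]_(d1, d2),
    (forall t, payoff_matrix (A t)) /\
    ~ [/\ sublinear (fun T => `|saddle_gap s A T|),
          sublinear_above (regret_x s A) &
          sublinear_above (regret_y s A)].
Proof.
exists (blocks R d1 d2); split; first exact: blocks_payoff_matrix.
case=> gap_o _ [g g_o reg_g].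
have e0 : (0 : R) < 1 / 100 by lra.
have [n1 gap_le] := sublinear_le e0 gap_o.
have [n2 g_le] := sublinear_le e0 g_o.
set k := maxn n1 n2.
(* The even exponent makes [W, T) a pennies phase; [T, 2T) lies in the dominant phase after it. Both
   T and 2T exceed the thresholds [n1] and [n2]. *)
pose W := (32 ^ k.*2)%N; pose T := (32 ^ k.*2.+1)%N.
have TW : T = (32 * W)%N by rewrite /T expnS.
have W_gt0 : (0 < W)%N by rewrite expn_gt0.
have kT : (k <= W)%N.
  by apply: leq_trans (ltnW (ltn_expl k.*2 _)); rewrite // -addnn leq_addr.
have {}gap_le n : (T <= n)%N -> saddle_gap s (blocks R d1 d2) n <= 1 / 100 * n%:R.
  move=> Tn; apply: le_trans (ler_norm _) _; rewrite -normr_id.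
  by apply: gap_le; lia.
have {}g_le n : (T <= n)%N -> regret_y s (blocks R d1 d2) n <= 1 / 100 * n%:R.
  move=> Tn; apply: le_trans (reg_g n) (le_trans (ler_norm _) _).
  by apply: g_le; lia.
have A_pennies t : (W <= t < T)%N -> blocks R d1 d2 t = pennies R d1 d2.
  by move=> tWT; rewrite /blocks (trunc_log_eq _ tWT)// odd_double.
have A_dominant t : (T <= t < T + T)%N -> blocks R d1 d2 t = dominant R d1 d2.
  move=> tT; rewrite /blocks (@trunc_log_eq _ k.*2.+1)//= ?odd_double//.
  by rewrite -/T expnS -/T; lia.
have WT : (W <= T)%N by lia.
have TT : (T + T)%:R = 2 * T%:R :> R by rewrite natrD; ring.
have := @regrets_two_blocks _ _ _ hd1 hd2 s _ W T hs
  (@blocks_payoff_matrix R d1 d2) WT A_pennies A_dominant (1 / 100 * T%:R)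
  (gap_le _ (leqnn _)) (g_le _ (leqnn _)).
rewrite mulrCA -TT => /(_ (gap_le _ (leq_addr _ _)) (g_le _ (leq_addr _ _))).
have : (0 : R) < W%:R by rewrite ltr0n.
(* With T = 32W and e = T/100 the inequality reads 8W <= 4.5W + 1.92W. *)
rewrite TW natrM; lra.
Qed.
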